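(* Let $k$ be a nonnegative integer. Then for all $n\geq 0$, \[\overline{pl}_{2k+1}(2n+1)\equiv \overline{p}(2n+1)\pmod 4.\]
   Context: A plane overpartition of $n$ is a plane partition of $n$ (an array $(\pi_{ij})_{i,j\geq1}$ of nonnegative integers, weakly decreasing along rows and down columns, with $\sum\pi_{ij}=n$) in which entries may be overlined subject to: in each row, the last occurrence of an integer may be overlined or not and all other occurrences of that integer in the row are not overlined; in each column, the first occurrence of an integer may be overlined or not and all other occurrences of that integer in the column are overlined. A $k$-rowed plane overpartition is a plane overpartition with at most $k$ (nonzero) rows; $\overline{pl}_k(n)$ is their number ($\overline{pl}_k(0)=1$), with generating function $\sum_{n\geq0}\overline{pl}_k(n)q^n=\prod_{n\geq1}\left(\frac{1+q^n}{1-q^n}\right)^{\min\{k,n\}}$. An overpartition of $n$ is a partition of $n$ in which the first occurrence of each part may be overlined; $\overline{p}(n)$ is the number of overpartitions of $n$ ($\overline{p}(0)=1$), with generating function $\prod_{n\geq1}\frac{1+q^n}{1-q^n}$. *)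

(* Defs.v *)
From mathcomp Require Import all_boot all_order all_algebra.
Set Implicit Arguments.
Unset Strict Implicit.
Unset Printing Implicit Defensive.

(* A plane partition of n has at most n nonzero columns, and all its entries
   are at most n; hence a plane partition of n with at most k nonzero rows is
   encoded by its top-left k x n corner, which contains all the nonzero
   entries. Rows are indexed by 'I_k and columns by 'I_n. *)
Definition is_plane_partition (k n : nat) (p : 'M['I_n.+1]_(k, n)) : bool :=
  [&& [forall i : 'I_k, forall j : 'I_n, forall j' : 'I_n,
         (j <= j') ==> (p i j' <= p i j)],
      [forall j : 'I_n, forall i : 'I_k, forall i' : 'I_k,
         (i <= i') ==> (p i' j <= p i j)]
    & \sum_(i < k) \sum_(j < n) (p i j : nat) == n].

(* o i j means that the entry p i j is overlined. Only the parts, i.e. the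
   nonzero entries, can be overlined, so the rules concern these alone. *)
Definition is_plane_overlining (k n : nat) (p : 'M['I_n.+1]_(k, n))
    (o : 'M[bool]_(k, n)) : bool :=
  [&& [forall i : 'I_k, forall j : 'I_n, o i j ==> (0 < p i j)],
      [forall i : 'I_k, forall j : 'I_n, forall j' : 'I_n,
         [&& 0 < p i j, j < j' & p i j == p i j'] ==> ~~ o i j]
    & [forall j : 'I_n, forall i : 'I_k, forall i' : 'I_k,
         [&& 0 < p i j, i < i' & p i j == p i' j] ==> o i' j]].

Definition plane_overpartitions (k n : nat) :
    {set 'M['I_n.+1]_(k, n) * 'M[bool]_(k, n)} :=
  [set po | is_plane_partition po.1 && is_plane_overlining po.1 po.2].

Definition num_plane_overpartitions (k n : nat) : nat :=
  #|plane_overpartitions k n|.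

(* A partition of n is encoded as a weakly decreasing sequence of length n,
   padded with zeros. *)
Definition is_partition (n : nat) (p : {ffun 'I_n -> 'I_n.+1}) : bool :=
  [forall i : 'I_n, forall j : 'I_n, (i <= j) ==> (p j <= p i)]
  && (\sum_(i < n) (p i : nat) == n).

Definition is_overlining (n : nat) (p : {ffun 'I_n -> 'I_n.+1})
    (o : {ffun 'I_n -> bool}) : bool :=
  [forall i : 'I_n, o i ==> (0 < p i)]
  && [forall i : 'I_n, forall j : 'I_n, (i < j) && (p i == p j) ==> ~~ o j].

Definition overpartitions (n : nat) :
    {set {ffun 'I_n -> 'I_n.+1} * {ffun 'I_n -> bool}} :=
  [set po | is_partition po.1 && is_overlining po.1 po.2].

Definition num_overpartitions (n : nat) : nat := #|overpartitions n|.

(* Main.v *)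
Require Import Defs.
From mathcomp Require Import all_boot all_order all_algebra.
From mathcomp Require Import zify.
Set Implicit Arguments.
Unset Strict Implicit.
Unset Printing Implicit Defensive.

(** The overlinings of a fixed plane partition are products of independent
    choices, cell by cell. A cell is free when it is the first occurrence of its
    value in its column and the last one in its row; every positive value that
    occurs has a free cell, so modulo 4 only the plane partitions with a single
    positive value and a single free cell count, each with 2 overlinings. These
    are the hooks filled with a constant: with arm [b] and leg [a] there is one
    exactly when [a + b + 1] divides the weight [N]. Since [N] is odd, the legs
    [a = 2m+1] and [a = 2m+2] give equally many hooks (they differ by whether
    [2m+2] divides [N]), hence modulo 2 only the leg [a = 0] remains, which
    counts the constant partitions of [N]. By the same argument the number of
    overpartitions is twice this count modulo 4. *)

(** * Counting independent choices, and counting pairs modulo 4 *)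

Lemma card_local_choices (T : finType) (A : T -> pred bool) :
  #|[set f : {ffun T -> bool} | [forall x, A x (f x)]]|
  = \prod_x (A x true + A x false).
Proof.
transitivity (\prod_x \sum_(c : bool) (A x c : nat)).
  (* Distributing the product over the sums gives one term per function [f], a product of 0/1
     indicators that is 1 exactly when [f] is admissible everywhere. *)
  rewrite bigA_distr_bigA /= -sum1_card big_mkcond /=.
  apply: eq_bigr => f _; rewrite inE.
  case: ifPn => [/forallP fA|/forallPn[x /negPf fx]].
    by rewrite big1 // => x _; rewrite fA.
  by rewrite (bigD1 x) //= fx.
by apply: eq_bigr => x _; rewrite big_bool.
Qed.

Lemma dvd4_local_choices (T : finType) (A : T -> pred bool) (x y : T) :
  x != y -> (forall c, A x c) -> (forall c, A y c) ->
  4 %| #|[set f : {ffun T -> bool} | [forall z, A z (f z)]]|.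
Proof.
move=> xy Ax Ay; rewrite card_local_choices (bigD1 x) //= (bigD1 y) 1?eq_sym //=.
by rewrite !Ax !Ay mulnA dvdn_mulr.
Qed.

Lemma card_local_choices0 (T : finType) (A : T -> pred bool) (x : T) :
  (forall c, ~~ A x c) ->
  #|[set f : {ffun T -> bool} | [forall z, A z (f z)]]| = 0.
Proof.
by move=> Ax; rewrite card_local_choices (bigD1 x) //= !(negPf (Ax _)).
Qed.

Lemma card_local_choices2 (T : finType) (A : T -> pred bool) (x : T) :
  (forall c, A x c) -> (forall y, y != x -> A y true = ~~ A y false) ->
  #|[set f : {ffun T -> bool} | [forall z, A z (f z)]]| = 2.
Proof.
move=> Ax Ay; rewrite card_local_choices (bigD1 x) //= !Ax big1 // => y yx.
by rewrite Ay //; case: (A y false).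
Qed.

(** To be used with [S] the partitions, [T] the overlinings and [D] the divisor data. Fibres over
    the image of [h] have 2 elements each; all others vanish modulo 4. *)
Lemma card_pairs_mod4 (S T I : finType) (P : pred S) (Q : S -> pred T)
    (D : {set I}) (h : I -> S) :
  {in D &, injective h} ->
  {in D, forall d, P (h d) /\ #|[set t | Q (h d) t]| = 2} ->
  (forall s, P s -> ~~ (4 %| #|[set t | Q s t]|) -> s \in h @: D) ->
  #|[set st : S * T | P st.1 && Q st.1 st.2]| = 2 * #|D| %[mod 4].
Proof.
move=> hI hD hS.
have -> : #|[set st : S * T | P st.1 && Q st.1 st.2]|
    = \sum_(s | P s) #|[set t | Q s t]|.
  rewrite -sum1_card (eq_bigl (fun st : S * T => P st.1 && Q st.1 st.2)); last first.
    by move=> st; rewrite inE.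
  rewrite -(pair_big_dep P Q (fun _ _ => 1)) /=.
  apply: eq_bigr => s _; rewrite -sum1_card.
  by apply: eq_bigl => t; rewrite inE.
rewrite (bigID (mem (h @: D))) /=.
have -> : \sum_(s | P s && (s \in h @: D)) #|[set t | Q s t]| = 2 * #|D|.
  rewrite (eq_bigl (mem (h @: D))); last first.
    move=> s /=; case: imsetP => [[d dD ->]|]; rewrite ?andbF //.
    by have [-> _] := hD d dD.
  rewrite (eq_bigr (fun=> 2)); last by move=> _ /imsetP[d dD ->]; have [] := hD d dD.
  by rewrite sum_nat_const card_in_imset // mulnC.
have /dvdnP[m ->] : 4 %| \sum_(s | P s && (s \notin h @: D)) #|[set t | Q s t]|.
  apply: dvdn_sum => s /andP[Ps sD]; apply: contraR sD; exact: hS.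
by rewrite addnC modnMDl.
Qed.

Lemma sum_leq_ord (m c : nat) (v : nat) : c <= m ->
  \sum_(i < m) (i < c) * v = c * v.
Proof.
move=> cm; rewrite -big_distrl /=; congr (_ * _).
rewrite -(big_mkord xpredT (fun i => (i < c) : nat)) (@big_cat_nat _ _ _ c) //=.
rewrite [X in X + _](eq_big_nat _ _ (F2 := fun=> 1)); last by move=> i /andP[_ ->].
rewrite [X in _ + X](eq_big_nat _ _ (F2 := fun=> 0)); last first.
  by move=> i /andP[ci _]; rewrite ltnNge ci.
by rewrite !sum_nat_const_nat subn0 muln1 muln0 addn0.
Qed.

(** * Plane overpartitions modulo 4 *)

Section PlaneOverpartitions.

Variables K N : nat.
Implicit Types (p : 'M['I_N.+2]_(K.+1, N.+1)) (x : 'I_K.+1 * 'I_N.+1).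

Definition right_repeat p x :=
  [exists j' : 'I_N.+1, (x.2 < j') && (p x.1 x.2 == p x.1 j')].

Definition above_repeat p x :=
  [exists i' : 'I_K.+1, (i' < x.1) && (p x.1 x.2 == p i' x.2)].

(** With [p] fixed, each overlining rule bears on a single cell. A positive entry is forced plain by
    a repeat to its right and forced overlined by a repeat above it; under both it has no admissible
    state, under neither it is free. *)
Definition plane_choice p x : pred bool := fun c =>
  [&& c ==> (0 < p x.1 x.2),
      (0 < p x.1 x.2) && right_repeat p x ==> ~~ c &
      (0 < p x.1 x.2) && above_repeat p x ==> c].

Lemma is_plane_overliningE p (o : 'M[bool]_(K.+1, N.+1)) :
  is_plane_overlining p o = [forall x, plane_choice p x (o x.1 x.2)].
Proof.
apply/idP/idP => [/and3P[/forallP H1 /forallP H2 /forallP H3]|/forallP H].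
  apply/forallP => -[i j]; rewrite /plane_choice /=; apply/and3P; split.
  - by have /forallP := H1 i; apply.
  - apply/implyP => /andP[p0 /existsP[j' /= /andP[jj' e]]].
    have /forallP/(_ j)/forallP/(_ j')/implyP := H2 i.
    by apply; rewrite p0 jj' e.
  - apply/implyP => /andP[p0 /existsP[i' /= /andP[ii' e]]].
    have /forallP/(_ i')/forallP/(_ i)/implyP := H3 j.
    by apply; rewrite -(eqP e) p0 ii' eqxx.
apply/and3P; split; apply/forallP => i; apply/forallP => j.
- by have /and3P[] := H (i, j).
- apply/forallP => j'; apply/implyP => /and3P[p0 jj' e].
  have /and3P[_ /implyP h _] := H (i, j); apply: h => /=.
  by rewrite p0 /=; apply/existsP; exists j'; rewrite /= jj' e.
- apply/forallP => i'; apply/implyP => /and3P[p0 jj' e].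
  have /and3P[_ _ /implyP h] := H (i', i); apply: h => /=.
  by rewrite -(eqP e) p0 /=; apply/existsP; exists j; rewrite /= jj' (eqP e) eqxx.
Qed.

Lemma card_plane_overlinings p :
  #|[set o | is_plane_overlining p o]|
  = #|[set f : {ffun 'I_K.+1 * 'I_N.+1 -> bool} | [forall x, plane_choice p x (f x)]]|.
Proof.
pose m (f : {ffun 'I_K.+1 * 'I_N.+1 -> bool}) := (\matrix_(i, j) f (i, j))%R.
have mI : injective m.
  by move=> f g /matrixP fg; apply/ffunP => -[i j]; have := fg i j; rewrite !mxE.
rewrite -(card_imset _ mI); apply: eq_card => o; rewrite inE is_plane_overliningE.
apply/idP/imsetP => [/forallP H|[f + ->]].
  exists [ffun x => o x.1 x.2]; last by apply/matrixP => i j; rewrite mxE ffunE.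
  by rewrite inE; apply/forallP => x; rewrite ffunE.
rewrite inE => /forallP H; apply/forallP => -[i j] /=; rewrite mxE; exact: H.
Qed.

(* Both moving up and moving right decrease the measure. *)
Lemma exists_free_cell p x : 0 < p x.1 x.2 ->
  exists y, p y.1 y.2 = p x.1 x.2 /\ forall c, plane_choice p y c.
Proof.
move=> px.
case: (@arg_minnP _ x (fun y => p y.1 y.2 == p x.1 x.2)
  (fun y => y.1 + (N - y.2)) (eqxx _)) => y /eqP yx ymin.
exists y; split=> // c; rewrite /plane_choice yx px implybT /=.
have -> : right_repeat p y = false.
  apply/existsP => -[j /andP[yj /eqP e]].
  have /= := ymin (y.1, j); rewrite -e yx eqxx => /(_ isT).
  have := ltn_ord j; lia.
have -> // : above_repeat p y = false.
apply/existsP => -[i /andP[yj /eqP e]].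
have /= := ymin (i, y.2); rewrite -e yx eqxx => /(_ isT).
by have := ltn_ord i; lia.
Qed.

(** The hook cornered at the top-left cell, with [a] cells below the corner and [b] cells to its
    right. *)
Definition in_hook (a b i j : nat) := (i == 0) && (j <= b) || (j == 0) && (i <= a).

Definition hook_mx (d : 'I_K.+1 * 'I_N.+1) : 'M['I_N.+2]_(K.+1, N.+1) :=
  (\matrix_(i, j)
     if in_hook d.1 d.2 i j then inord (N.+1 %/ (d.1 + d.2).+1) else ord0)%R.

Definition hook_divisors : {set 'I_K.+1 * 'I_N.+1} :=
  [set d : 'I_K.+1 * 'I_N.+1 | (d.1 + d.2).+1 %| N.+1].

Lemma hook_mxE d i j :
  hook_mx d i j = in_hook d.1 d.2 i j * (N.+1 %/ (d.1 + d.2).+1) :> nat.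
Proof.
rewrite mxE; case: ifP => _; rewrite ?mul0n //= mul1n inordK // ltnS.
exact: leq_div.
Qed.

Lemma sum_hook (d : 'I_K.+1 * 'I_N.+1) v :
  \sum_(i < K.+1) \sum_(j < N.+1) in_hook d.1 d.2 i j * v = (d.1 + d.2).+1 * v.
Proof.
(* The top row contributes [b.+1] cells; each lower row contributes at most its first cell, [a] in
   all. *)
case: d => a b /=; rewrite big_ord_recl /=.
rewrite (eq_bigr (fun j : 'I_N.+1 => (j < b.+1) * v)); last first.
  by move=> j _; congr (nat_of_bool _ * _); rewrite /in_hook /=; lia.
rewrite sum_leq_ord; last exact: ltn_ord.
rewrite (eq_bigr (fun i : 'I_K => (i < a) * v)); last first.
  move=> i _; rewrite big_ord_recl big1 /= => [|j _]; last first.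
    by rewrite /in_hook.
  by rewrite addn0; congr (nat_of_bool _ * _); rewrite /in_hook /bump /=; lia.
rewrite sum_leq_ord; last by have := ltn_ord a; lia.
by rewrite -mulnDl; congr (_ * _); lia.
Qed.

Lemma hook_value_gt0 d : d \in hook_divisors -> 0 < N.+1 %/ (d.1 + d.2).+1.
Proof. by rewrite inE => dN; rewrite divn_gt0 // dvdn_leq. Qed.

Lemma hook_mx_gt0 d i j :
  d \in hook_divisors -> (0 < hook_mx d i j) = in_hook d.1 d.2 i j.
Proof.
by move=> /hook_value_gt0 v0; rewrite hook_mxE; case: in_hook; rewrite ?mul1n.
Qed.

Lemma hook_mx_inj : {in hook_divisors &, injective hook_mx}.
Proof.
move=> [a b] [a' b'] dD dD' e.
have E (i : 'I_K.+1) (j : 'I_N.+1) : in_hook a b i j = in_hook a' b' i j.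
  by have := hook_mx_gt0 i j dD; rewrite e (hook_mx_gt0 i j dD').
(* The tips of both legs and both arms, tested for membership in the other hook, give the
   inequalities in both directions. *)
have := (E a ord0, E a' ord0, E ord0 b, E ord0 b').
rewrite /in_hook /= => -[[[E1 E2] E3] E4].
by congr (_, _); apply: val_inj => /=; lia.
Qed.

Lemma hook_mx_partition d : d \in hook_divisors -> is_plane_partition (hook_mx d).
Proof.
rewrite inE => dN; apply/and3P; split.
- apply/forallP => i; apply/forallP => j; apply/forallP => j'; apply/implyP => jj'.
  rewrite !hook_mxE leq_mul2r; apply/orP; right.
  by rewrite /in_hook; case: d {dN} => a b /=; lia.
- apply/forallP => j; apply/forallP => i; apply/forallP => i'; apply/implyP => ii'.
  rewrite !hook_mxE leq_mul2r; apply/orP; right.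
  by rewrite /in_hook; case: d {dN} => a b /=; lia.
under eq_bigr => i _ do under eq_bigr => j _ do rewrite hook_mxE.
by rewrite sum_hook mulnC divnK.
Qed.

Lemma hook_mx_eq d i j i' j' : d \in hook_divisors ->
  (hook_mx d i j == hook_mx d i' j') = (in_hook d.1 d.2 i j == in_hook d.1 d.2 i' j').
Proof.
move=> /hook_value_gt0 v0; rewrite -val_eqE /= !hook_mxE eqn_mul2r.
by rewrite eqn0Ngt v0 /=; do 2 case: in_hook.
Qed.

(** The only free cell is the tip of the arm. The cells to its left have a repeat to the right,
    those of the leg below the corner have a repeat above, and zeros stay plain. *)
Lemma card_hook_overlinings d : d \in hook_divisors ->
  #|[set o | is_plane_overlining (hook_mx d) o]| = 2.
Proof.
move=> dD; rewrite card_plane_overlinings.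
have rR x : right_repeat (hook_mx d) x
    = [exists j' : 'I_N.+1,
        (x.2 < j') && (in_hook d.1 d.2 x.1 x.2 == in_hook d.1 d.2 x.1 j')].
  by apply: eq_existsb => j; rewrite hook_mx_eq.
have aR x : above_repeat (hook_mx d) x
    = [exists i' : 'I_K.+1,
        (i' < x.1) && (in_hook d.1 d.2 x.1 x.2 == in_hook d.1 d.2 i' x.2)].
  by apply: eq_existsb => j; rewrite hook_mx_eq.
case: d dD rR aR => a b dD rR aR.
apply: (@card_local_choices2 _ _ (ord0, b)) => [c|[i j] ij].
  rewrite /plane_choice hook_mx_gt0 // rR aR /=.
  rewrite {1}/in_hook leqnn implybT /=; apply/andP; split; apply/implyP => /andP[_].
    case/existsP => j /andP[bj]; rewrite /in_hook /=; lia.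
  by case/existsP.
rewrite /plane_choice hook_mx_gt0 // rR aR /=.
case hij: (in_hook a b i j) => //=.
case: (posnP i) => i0.
  have jb : j < b.
    have : j != b.
      by apply: contra ij => /eqP ->; rewrite xpair_eqE eqxx andbT -val_eqE /= i0.
    by move: hij; rewrite /in_hook i0 -val_eqE /=; have := ltn_ord a; lia.
  have -> /= : [exists j' : 'I_N.+1, (j < j') && (true == in_hook a b i j')].
    by apply/existsP; exists b; rewrite jb /in_hook i0 leqnn.
  case: existsP => // -[i' /andP[]]; by rewrite i0.
have j0 : j = 0 :> nat by move: hij; rewrite /in_hook; lia.
have -> /= : [exists i' : 'I_K.+1, (i' < i) && (true == in_hook a b i' j)].
  by apply/existsP; exists ord0; rewrite i0 /in_hook j0.
case: existsP => // -[j' /andP[jj']]; rewrite /in_hook; lia.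
Qed.

Lemma non_dvd4_hook p : is_plane_partition p ->
  ~~ (4 %| #|[set o | is_plane_overlining p o]|) -> p \in hook_mx @: hook_divisors.
Proof.
rewrite card_plane_overlinings => /and3P[H1 H2 /eqP psum] N4.
have prow i (j j' : 'I_N.+1) : j <= j' -> p i j' <= p i j.
  by move: H1 => /forallP/(_ i)/forallP/(_ j)/forallP/(_ j')/implyP.
have pcol j (i i' : 'I_K.+1) : i <= i' -> p i' j <= p i j.
  by move: H2 => /forallP/(_ j)/forallP/(_ i)/forallP/(_ i')/implyP.
set v := p ord0 ord0.
have ple i j : p i j <= v.
  exact: leq_trans (prow i ord0 j (leq0n j)) (pcol ord0 ord0 i (leq0n i)).
have v0 : 0 < v.
  rewrite lt0n; apply/eqP => v0; move: psum; rewrite big1 // => i _.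
  by rewrite big1 // => j _; have := ple i j; rewrite v0; lia.
(* A count of 0 is also a multiple of 4, so every cell has an admissible state. *)
have conflict x : ~ forall c, ~~ plane_choice p x c.
  by move=> cx; move: N4; rewrite (card_local_choices0 cx).
(* A second positive value would have a free cell of its own, and two free cells give a factor 4. *)
have pv i j : 0 < p i j -> p i j = v.
  move=> pij; apply/eqP/negPn/negP => nv.
  have [y [py fy]] := @exists_free_cell p (i, j) pij.
  have [z [pz fz]] := @exists_free_cell p (ord0, ord0) v0.
  move/negP: N4; apply; apply: (dvd4_local_choices _ fy fz).
  by apply: contraNneq nv => yz; rewrite -[p i j]py yz pz.
(* Otherwise the cell [(i, ord0)] would hold [v], repeated both to its right at [(i, j)] and above
   it at the corner: no state is left for it. *)
have inner (i : 'I_K.+1) (j : 'I_N.+1) : 0 < i -> 0 < j -> p i j = 0 :> nat.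
  move=> i0 j0; apply/eqP; rewrite eqn0Ngt; apply/negP => pij.
  have pi0 : 0 < p i ord0 by apply: leq_trans pij (prow _ _ _ _).
  apply: (conflict (i, ord0)) => c; rewrite /plane_choice /= pi0 /=.
  have -> : right_repeat p (i, ord0).
    by apply/existsP; exists j; rewrite /= j0 (pv _ _ pij) (pv _ _ pi0) eqxx.
  have -> : above_repeat p (i, ord0).
    by apply/existsP; exists ord0; rewrite /= i0 (pv _ _ pi0) eqxx.
  by case: c.
(* Leg and arm end at the last positive entries of the first column and of the first row. *)
have [a a0 amax] := @arg_maxnP _ (ord0 : 'I_K.+1) (fun i => 0 < p i ord0) val v0.
have [b b0 bmax] := @arg_maxnP _ (ord0 : 'I_N.+1) (fun j => 0 < p ord0 j) val v0.
have pE i j : p i j = in_hook a b i j * v :> nat.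
  have pgt : (0 < p i j) = in_hook a b i j.
    rewrite /in_hook; case: (posnP i) => [i0|ip].
      have -> : i = ord0 by apply: val_inj.
      have -> : (0 < p ord0 j) = (j <= b).
        apply/idP/idP => [|jb]; first exact: bmax.
        exact: leq_trans b0 (prow _ _ _ jb).
      by rewrite /=; lia.
    case: (posnP j) => [j0|jp]; last first.
      by rewrite inner //; lia.
    have -> : j = ord0 by apply: val_inj.
    have -> : (0 < p i ord0) = (i <= a).
      apply/idP/idP => [|ia]; first exact: amax.
      exact: leq_trans a0 (pcol _ _ _ ia).
    by rewrite /=; lia.
  rewrite -pgt; case: posnP => [->//|/pv ->]; by rewrite mul1n.
move: psum; under eq_bigr => i _ do under eq_bigr => j _ do rewrite pE.
rewrite (sum_hook (a, b)) /= => psum.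
have abN : (a + b).+1 %| N.+1 by apply/dvdnP; exists v; rewrite mulnC psum.
have vE : N.+1 %/ (a + b).+1 = v.
  by apply/eqP; rewrite -(eqn_pmul2l (ltn0Sn (a + b))) mulnC divnK // psum.
apply/imsetP; exists (a, b); first by rewrite inE.
apply/matrixP => i j; apply: val_inj => /=.
by rewrite hook_mxE /= pE vE.
Qed.

Lemma num_plane_overpartitions_mod4 :
  num_plane_overpartitions K.+1 N.+1
  = 2 * \sum_(a < K.+1) \sum_(b < N.+1) ((a + b).+1 %| N.+1) %[mod 4].
Proof.
rewrite /num_plane_overpartitions /plane_overpartitions.
rewrite (card_pairs_mod4 hook_mx_inj (Q := fun p o => is_plane_overlining p o)
  _ non_dvd4_hook) => [|d dD]; last first.
  by split; [exact: hook_mx_partition | exact: card_hook_overlinings].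
congr (2 * _ %% 4); rewrite pair_big -sum1_card big_mkcond /=.
by apply: eq_bigr => d _; rewrite inE; case: ifP.
Qed.

End PlaneOverpartitions.

(** * Ordinary overpartitions modulo 4 *)

Section Overpartitions.

Variable N : nat.
Implicit Types (p : {ffun 'I_N.+1 -> 'I_N.+2}).

(** Leaving a part plain is always admissible here, so no position is without a state; the free
    positions are the first occurrences of the positive values. *)
Definition over_choice p (i : 'I_N.+1) : pred bool := fun c =>
  (c ==> (0 < p i)) && ([exists i' : 'I_N.+1, (i' < i) && (p i' == p i)] ==> ~~ c).

Lemma card_overlinings p :
  #|[set o | is_overlining p o]|
  = #|[set f : {ffun 'I_N.+1 -> bool} | [forall x, over_choice p x (f x)]]|.
Proof.
apply: eq_card => o; rewrite !inE; apply/idP/idP.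
  case/andP=> /forallP H1 /forallP H2; apply/forallP => i; apply/andP; split => //.
  apply/implyP => /existsP[j ji].
  by have /forallP/(_ i)/implyP := H2 j; apply.
move=> /forallP H; apply/andP; split; apply/forallP => i; first by have /andP[] := H i.
apply/forallP => j; apply/implyP => ij; have /andP[_ /implyP] := H j; apply.
by apply/existsP; exists i.
Qed.

(** For [b] in [flat_divisors], the partition into [b.+1] equal parts: a hook with leg 0. *)
Definition flat_partition (b : 'I_N.+1) : {ffun 'I_N.+1 -> 'I_N.+2} :=
  [ffun i : 'I_N.+1 => if i <= b then inord (N.+1 %/ b.+1) else ord0].

Definition flat_divisors : {set 'I_N.+1} := [set b : 'I_N.+1 | b.+1 %| N.+1].

Lemma flat_partitionE b i :
  flat_partition b i = (i < b.+1) * (N.+1 %/ b.+1) :> nat.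
Proof.
rewrite ffunE ltnS; case: ifP => _; rewrite ?mul0n //= mul1n inordK // ltnS.
exact: leq_div.
Qed.

Lemma flat_partition_gt0 b i :
  b \in flat_divisors -> (0 < flat_partition b i) = (i <= b).
Proof.
rewrite inE => bN; rewrite flat_partitionE ltnS.
have v0 : 0 < N.+1 %/ b.+1 by rewrite divn_gt0 // dvdn_leq.
by case: (i <= b); rewrite ?mul1n.
Qed.

Lemma flat_partition_inj : {in flat_divisors &, injective flat_partition}.
Proof.
move=> b b' bD bD' e.
have E (i : 'I_N.+1) : (i <= b) = (i <= b').
  by rewrite -(flat_partition_gt0 i bD) -(flat_partition_gt0 i bD') e.
by apply: val_inj => /=; have := (E b, E b') => -[]; lia.
Qed.

Lemma flat_partition_partition b :
  b \in flat_divisors -> is_partition (flat_partition b).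
Proof.
rewrite inE => bN; apply/andP; split.
  apply/forallP => i; apply/forallP => j; apply/implyP => ij.
  by rewrite !flat_partitionE leq_mul2r; apply/orP; right; lia.
under eq_bigr => i _ do rewrite flat_partitionE.
by rewrite sum_leq_ord ?ltn_ord // mulnC divnK.
Qed.

Lemma card_flat_overlinings b : b \in flat_divisors ->
  #|[set o | is_overlining (flat_partition b) o]| = 2.
Proof.
move=> bD; rewrite card_overlinings.
apply: (@card_local_choices2 _ _ ord0) => [c|i i0].
  rewrite /over_choice flat_partition_gt0 // implybT /=.
  by apply/implyP => /existsP[].
rewrite /over_choice flat_partition_gt0 //=.
case: leqP => [ib|_]; last by rewrite implybT.
have -> // : [exists i' : 'I_N.+1,
    (i' < i) && (flat_partition b i' == flat_partition b i)].
apply/existsP; exists ord0.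
by rewrite -val_eqE /= !flat_partitionE /= !ltnS ib lt0n i0 /=.
Qed.

(** Two distinct positive values have distinct first occurrences, both free, so only constant
    partitions escape divisibility by 4. *)
Lemma non_dvd4_flat p : is_partition p ->
  ~~ (4 %| #|[set o | is_overlining p o]|) -> p \in flat_partition @: flat_divisors.
Proof.
rewrite card_overlinings => /andP[H /eqP psum] N4.
have pdec (i j : 'I_N.+1) : i <= j -> p j <= p i.
  by move: H => /forallP/(_ i)/forallP/(_ j)/implyP.
set v := p ord0.
have ple i : p i <= v by exact: pdec.
have v0 : 0 < v.
  rewrite lt0n; apply/eqP => v0; move: psum; rewrite big1 // => i _.
  by have := ple i; rewrite v0; lia.
have pv i : 0 < p i -> p i = v.
  move=> pi; apply/eqP/negPn/negP => nv.
  (* [y] is the first occurrence of the value [p i]; the first occurrence of [v] is [ord0]. *)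
  have [y /eqP py ymin] := @arg_minnP _ i (fun y => p y == p i) val (eqxx _).
  move/negP: N4; apply; apply: (@dvd4_local_choices _ _ y ord0) => [|c|c].
  - by apply: contraNneq nv => yz; rewrite -py yz.
  - rewrite /over_choice py pi implybT /=; apply/implyP => /existsP[z /andP[zy pz]].
    by have := ymin _ pz; rewrite leqNgt zy.
  - rewrite /over_choice v0 implybT /=.
    by apply/implyP => /existsP[].
have [b b0 bmax] := @arg_maxnP _ (ord0 : 'I_N.+1) (fun j => 0 < p j) val v0.
have pE i : p i = (i < b.+1) * v :> nat.
  have <- : (0 < p i) = (i < b.+1).
    apply/idP/idP => [|ib]; first exact: bmax.
    exact: leq_trans b0 (pdec _ _ ib).
  case: posnP => [->//|/pv ->]; by rewrite mul1n.
move: psum; under eq_bigr => i _ do rewrite pE.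
rewrite sum_leq_ord ?ltn_ord // => psum.
have bN : b.+1 %| N.+1 by apply/dvdnP; exists v; rewrite mulnC psum.
have vE : N.+1 %/ b.+1 = v.
  by apply/eqP; rewrite -(eqn_pmul2l (ltn0Sn b)) mulnC divnK // psum.
apply/imsetP; exists b; first by rewrite inE.
by apply/ffunP => i; apply: val_inj => /=; rewrite flat_partitionE pE vE.
Qed.

Lemma num_overpartitions_mod4 :
  num_overpartitions N.+1 = 2 * \sum_(b < N.+1) (b.+1 %| N.+1) %[mod 4].
Proof.
rewrite /num_overpartitions /overpartitions.
rewrite (card_pairs_mod4 flat_partition_inj (Q := fun p o => is_overlining p o)
  _ non_dvd4_flat) => [|d dD]; last first.
  by split; [exact: flat_partition_partition | exact: card_flat_overlinings].
congr (2 * _ %% 4); rewrite -sum1_card big_mkcond /=.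
by apply: eq_bigr => d _; rewrite inE; case: ifP.
Qed.

End Overpartitions.

(** * Divisor sums modulo 2 and the conclusion *)

Lemma large_divisors_recl (a N : nat) :
  \sum_(b < N.+1) ((a + b).+1 %| N.+1)
  = (a.+1 %| N.+1) + \sum_(b < N.+1) ((a.+1 + b).+1 %| N.+1).
Proof.
(* The two ranges of candidate divisors differ only at their ends, and the extra upper one,
   [a + N + 2], is too large to divide [N.+1]. *)
rewrite big_ord_recl [in RHS]big_ord_recr /= addn0.
have -> : ((a.+1 + N).+1 %| N.+1) = false.
  by apply/negP => /dvdn_leq -/(_ isT); lia.
rewrite addn0; congr (_ + _); apply: eq_bigr => b _.
by rewrite /bump /= addnA addn1.
Qed.

Lemma sum_large_divisors_mod2 (k n : nat) :
  \sum_(a < (2 * k).+1) \sum_(b < (2 * n).+1) ((a + b).+1 %| (2 * n).+1)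
  = \sum_(b < (2 * n).+1) (b.+1 %| (2 * n).+1) %[mod 2].
Proof.
elim: k => [|k IH].
  by rewrite big_ord_recl big_ord0 addn0.
have -> : (2 * k.+1).+1 = (2 * k).+3 by lia.
(* The legs [2k+1] and [2k+2] are split off; their sums differ by whether the even number [2k+2]
   divides the odd weight. It does not, so together they contribute an even number. *)
rewrite big_ord_recr big_ord_recr /=.
rewrite [X in _ + X + _]large_divisors_recl.
have -> : ((2 * k).+2 %| (2 * n).+1) = false.
  apply/negP => kn; have : 2 %| (2 * n).+1.
    by apply: dvdn_trans kn; rewrite dvdn2 /= negbK mul2n odd_double.
  by rewrite dvdn2 /= mul2n odd_double.
by rewrite add0n -addnA addnn -mul2n -modnDmr modnMr addn0.
Qed.

Theorem theorem1p6 (k n : nat) :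
  num_plane_overpartitions (2 * k + 1) (2 * n + 1)
    = num_overpartitions (2 * n + 1) %[mod 4].
Proof.
rewrite !addn1 num_plane_overpartitions_mod4 num_overpartitions_mod4.
(* Cancelling the common factor 2 turns the congruence modulo 4 into one modulo 2. *)
by rewrite -[4]/(2 * 2) -!muln_modr sum_large_divisors_mod2.
Qed.
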